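(* Let $p$ be an odd prime and let $n$ be a positive non-square integer with $n\equiv 0\pmod p$. For $\alpha=\frac{a+\sqrt n}{c}\in Q^*(\sqrt n)$ write $b=\frac{a^2-n}{c}$, and put $$A_1=\{\alpha\in Q^*(\sqrt n):(c/p)=1\},\qquad A_2=\{\alpha\in Q^*(\sqrt n):(c/p)=-1\},$$ $$C_1=\{\alpha\in Q^*(\sqrt n): c\equiv 0 \ (\mathrm{mod}\ p),\ (b/p)=1\},\qquad C_2=\{\alpha\in Q^*(\sqrt n): c\equiv 0 \ (\mathrm{mod}\ p),\ (b/p)=-1\}.$$ Then the sets $S_1=A_1\cup C_1$ and $S_2=A_2\cup C_2$ are two $G$-subsets of $Q^*(\sqrt n)$.
   Context: $G=\langle x,y: x^2=y^3=1\rangle$ is the modular group $PSL(2,\mathbb Z)$, generated by the linear fractional transformations $x: z\mapsto \frac{-1}{z}$ and $y: z\mapsto \frac{z-1}{z}$. For a positive non-square integer $n$, $$Q^*(\sqrt n)=\left\{\frac{a+\sqrt n}{c}: a,\ c,\ b=\frac{a^2-n}{c}\in\mathbb Z,\ c\neq 0,\ \gcd(a,b,c)=1\right\}.$$ The integers $a,b,c$ are uniquely determined by the element. The set $Q^*(\sqrt n)$ is invariant under $G$. A $G$-subset of $Q^*(\sqrt n)$ is a subset invariant under the action of $G$. $(t/p)$ is the Legendre symbol: $1$ if $t\not\equiv0\pmod p$ is a quadratic residue of $p$, $-1$ if $t\not\equiv 0\pmod p$ is a quadratic non-residue, and $0$ if $t\equiv 0\pmod p$. *)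

(* Defs.v *)
From HB Require Import structures.
From mathcomp Require Import all_boot all_order all_algebra.
From mathcomp Require Import boolp classical_sets reals.
From mathcomp Require Import ring lra zify.

Set Implicit Arguments.
Unset Strict Implicit.
Unset Printing Implicit Defensive.

Import Order.TTheory GRing.Theory Num.Theory.

Local Open Scope classical_set_scope.
Local Open Scope ring_scope.

Definition legendre (t : int) (p : nat) : int :=
  if (p%:Z %| t)%Z then 0
  else if `[< exists u : int, (u ^+ 2 = t %[mod p%:Z])%Z >] then 1 else -1.

(** The modular group, as a group of transformations of the real projective
    line [option R], where [None] is the point at infinity. *)

Definition modx (R : realType) (z : option R) : option R :=
  match z with
  | None => Some 0
  | Some z => if z == 0 then None else Some (-1 / z)
  end.

Definition mody (R : realType) (z : option R) : option R :=
  match z with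
  | None => Some 1
  | Some z => if z == 0 then None else Some ((z - 1) / z)
  end.

Inductive modular_group (R : realType) : set (option R -> option R) :=
| modular_group_id : modular_group id
| modular_group_x : modular_group (@modx R)
| modular_group_y : modular_group (@mody R)
| modular_group_comp g h :
    modular_group g -> modular_group h -> modular_group (g \o h)
| modular_group_inv g h :
    modular_group g -> cancel g h -> cancel h g -> modular_group h.

(** [quad_irr n alpha a b c]: [alpha] is the element (a + sqrt n) / c of
    Q^*(sqrt n), with b = (a^2 - n) / c. For non-square [n] the integers
    [a], [b], [c] are determined by [alpha]. *)
Definition quad_irr (R : realType) (n : nat) (alpha : R) (a b c : int) : Prop :=
  [/\ c != 0, b * c = a ^+ 2 - n%:Z, gcdz (gcdz a b) c = 1
    & alpha = (a%:~R + Num.sqrt n%:R) / c%:~R].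

Definition Qstar (R : realType) (n : nat) : set R :=
  [set alpha | exists a b c : int, quad_irr n alpha a b c].

Definition G_subset (R : realType) (n : nat) (S : set R) : Prop :=
  S `<=` @Qstar R n /\
  forall g, modular_group g -> g @` (Some @` S) `<=` Some @` S.

Definition classA (R : realType) (n p : nat) (e : int) : set R :=
  [set alpha | exists a b c : int,
     quad_irr n alpha a b c /\ legendre c p = e].

Definition classC (R : realType) (n p : nat) (e : int) : set R :=
  [set alpha | exists a b c : int,
     [/\ quad_irr n alpha a b c, (p%:Z %| c)%Z & legendre b p = e]].

(** [modular_group] is the group PSL(2, Z) of transformations
    z |-> (a z + b) / (c z + d) with integer a, b, c, d and ad - bc = 1. *)

Definition moebius (R : realType) (a b c d : int) (z : option R) : option R :=
  match z with
  | None => if c == 0 then None else Some (a%:~R / c%:~R)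
  | Some z => if c%:~R * z + d%:~R == 0 then None
              else Some ((a%:~R * z + b%:~R) / (c%:~R * z + d%:~R))
  end.

Section ModularGroup.
Variable R : realType.
Implicit Types (z : option R) (a b c d : int) (g : option R -> option R).

#[local] Definition toP (u v : R) : option R := if v == 0 then None else Some (u / v).
#[local] Definition num z : R := if z is Some z then z else 1.
#[local] Definition den z : R := if z is Some z then 1 else 0.

Let moebiusE a b c d z : moebius a b c d z =
  toP (a%:~R * num z + b%:~R * den z) (c%:~R * num z + d%:~R * den z).
Proof.
by case: z => [z|]; rewrite /moebius /toP /= !(mulr1, mulr0, addr0) ?intr_eq0.
Qed.

Let toP_scale (k u v : R) : k != 0 -> toP (k * u) (k * v) = toP u v.
Proof.
move=> k0; rewrite /toP mulf_eq0 (negbTE k0) /=; case: eqP => // /eqP v0.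
by congr Some; field; rewrite k0 v0.
Qed.

Let toP_hom (u v : R) : (u != 0) || (v != 0) ->
  exists2 k, k != 0 & u = k * num (toP u v) /\ v = k * den (toP u v).
Proof.
rewrite /toP; case: (eqVneq v 0) => [->|v0 _] /=.
  by rewrite orbF => u0; exists u; rewrite // mulr1 mulr0.
by exists v; rewrite // mulr1; split=> //; field.
Qed.

Lemma moebius_comp a b c d a' b' c' d' : a' * d' - b' * c' = 1 ->
  @moebius R a b c d \o moebius a' b' c' d' =
  moebius (a * a' + b * c') (a * b' + b * d') (c * a' + d * c') (c * b' + d * d').
Proof.
move=> D; apply/funext => z /=; rewrite [moebius a' _ _ _ z]moebiusE.
set u := (X in toP X _); set v := (X in toP _ X).
have nz : (u != 0) || (v != 0).
  rewrite -negb_and; apply/negP => /andP[/eqP u0 /eqP v0].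
  have D' : a'%:~R * d'%:~R - b'%:~R * c'%:~R = 1 :> R.
    by rewrite -!intrM -intrB D.
  have e1 : num z = d'%:~R * u - b'%:~R * v.
    by rewrite -[LHS]mul1r -[X in X * _ = _]D' /u /v; ring.
  have e2 : den z = a'%:~R * v - c'%:~R * u.
    by rewrite -[LHS]mul1r -[X in X * _ = _]D' /u /v; ring.
  have : den z = 0 by rewrite e2 u0 v0; ring.
  have : num z = 0 by rewrite e1 u0 v0; ring.
  by case: (z) => [w|] /= => [_|] /eqP; rewrite oner_eq0.
have [k k0 [eu ev]] := toP_hom nz.
rewrite !moebiusE -(toP_scale _ _ k0) !mulrDr !(mulrCA k) -eu -ev /u /v.
by congr toP; rewrite !intrD !intrM; ring.
Qed.

Lemma moebius1 : @moebius R 1 0 0 1 = id.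
Proof.
apply/funext => -[z|] //=.
by rewrite !mulr1z mul0r add0r oner_eq0 mul1r addr0 divr1.
Qed.

Lemma modxE : @modx R = moebius 0 (-1) 1 0.
Proof.
apply/funext => -[z|] /=; first by rewrite mul1r addr0 mul0r add0r mulrN1z.
by rewrite mul0r.
Qed.

Lemma modyE : @mody R = moebius 1 (-1) 1 0.
Proof.
apply/funext => -[z|] /=; first by rewrite !mul1r addr0 mulrN1z.
by rewrite divr1.
Qed.

Lemma modx_order2 : @modx R \o @modx R = id.
Proof.
rewrite modxE moebius_comp //; apply/funext => z.
rewrite moebiusE -(@toP_scale (-1)) ?oppr_eq0 ?oner_eq0 // -[RHS]/(id z).
by rewrite -moebius1 moebiusE; congr toP; rewrite !(rmorphD, rmorphM, rmorphN) /=; ring.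
Qed.

Lemma mody_order3 : @mody R \o @mody R \o @mody R = id.
Proof.
rewrite modyE !moebius_comp //; apply/funext => z.
rewrite moebiusE -(@toP_scale (-1)) ?oppr_eq0 ?oner_eq0 // -[RHS]/(id z).
by rewrite -moebius1 moebiusE; congr toP; rewrite !(rmorphD, rmorphM, rmorphN) /=; ring.
Qed.

Let moebiusN a b c d : @moebius R (- a) (- b) (- c) (- d) = moebius a b c d.
Proof.
apply/funext => z; rewrite moebiusE -(@toP_scale (-1)) ?oppr_eq0 ?oner_eq0 //.
by rewrite moebiusE; congr toP; rewrite !rmorphN /=; ring.
Qed.

Let trans (k : int) : modular_group (@moebius R 1 k 0 1).
Proof.
have T1 : modular_group (@moebius R 1 1 0 1).
  have -> : @moebius R 1 1 0 1 = @mody R \o @modx R.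
    rewrite modyE modxE moebius_comp // -[LHS]moebiusN.
    by congr (moebius _ _ _ _); ring.
  by apply: modular_group_comp; [exact: modular_group_y|exact: modular_group_x].
have Tn (m : nat) : modular_group (@moebius R 1 m%:Z 0 1).
  elim: m => [|m IH]; first by rewrite moebius1; exact: modular_group_id.
  suff -> : @moebius R 1 m.+1%:Z 0 1 = moebius 1 1 0 1 \o moebius 1 m%:Z 0 1.
    exact: modular_group_comp.
  by rewrite moebius_comp; [congr (moebius _ _ _ _)|]; lia.
have comp0 (i j : int) : i + j = 0 ->
    @moebius R 1 i 0 1 \o moebius 1 j 0 1 = id.
  by move=> ij; rewrite moebius_comp -?moebius1; [congr (moebius _ _ _ _)|]; lia.
case: (lerP 0 k) => k0; first by rewrite -(gez0_abs k0); exact: Tn.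
apply: (modular_group_inv (Tn `|k|%N)) => z.
  by rewrite -[LHS]/((_ \o _) z) comp0 //; lia.
by rewrite -[LHS]/((_ \o _) z) comp0 //; lia.
Qed.

Lemma modular_groupP g : modular_group g <->
  exists a b c d : int, a * d - b * c = 1 /\ g = moebius a b c d.
Proof.
split.
  elim=> {g} [|||g h _ [a [b [c [d [D ->]]]]] _ [a' [b' [c' [d' [D' ->]]]]]|
              g h _ [a [b [c [d [D ->]]]]] _ hK].
  - by exists 1, 0, 0, 1; rewrite moebius1.
  - by exists 0, (-1), 1, 0; rewrite modxE.
  - by exists 1, (-1), 1, 0; rewrite modyE.
  - do 4 eexists; split; last exact: moebius_comp.
    transitivity ((a * d - b * c) * (a' * d' - b' * c')); first by ring.
    by rewrite D D'.
  - exists d, (- b), (- c), a; split; first by rewrite -D; ring.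
    apply/funext => z; rewrite -{2}(hK z) -[RHS]/((_ \o _) (h z)) moebius_comp //.
    rewrite -[LHS]/(id (h z)) -moebius1.
    by congr (moebius _ _ _ _ _); lia.
move=> [a [b [c [d [D ->]]]]] {g}.
have [m] := ubnP `|c|%N; elim: m => // m IH in a b c d D *.
move=> cm; case: (eqVneq c 0) => [c0|c0].
  rewrite c0 in D *; have ad : a * d = 1 by rewrite -D; ring.
  have [[-> ->]|[-> ->]] : (a = 1 /\ d = 1) \/ (a = -1 /\ d = -1).
    have /eqP : (`|a| * `|d|)%N = 1%N by rewrite -abszM ad.
    rewrite muln_eq1 => /andP[/eqP a1 _].
    have [e|e] : a = 1 \/ a = -1 by lia.
      by left; rewrite e in ad *; lia.
    by right; rewrite e in ad *; lia.
    exact: trans.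
  by rewrite -moebiusN oppr0 opprK; exact: trans.
pose q := (a %/ c)%Z; pose r := (a %% c)%Z.
have aE : a = q * c + r by exact: divz_eq.
have rc : (`|r| < `|c|)%N by have := modz_ge0 a c0; have := ltz_mod a c0; lia.
suff -> : @moebius R a b c d =
    moebius 1 q 0 1 \o (@modx R \o moebius c d (- r) (q * d - b)).
  apply: modular_group_comp; first exact: trans.
  apply: modular_group_comp; first exact: modular_group_x.
  by apply: IH; [rewrite -D aE; ring|lia].
have D' : c * (q * d - b) - d * (- r) = 1 by rewrite -D aE; ring.
rewrite modxE moebius_comp // moebius_comp; last by rewrite -[RHS]D'; ring.
by rewrite aE; congr (moebius _ _ _ _); ring.
Qed.

End ModularGroup.

(* Main.v *)
(** An element (a + sqrt n) / c corresponds to the binary quadratic form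
    f(X, Y) = b X^2 + 2 a X Y + c Y^2 of determinant bc - a^2 = -n, on which the
    modular group acts by unimodular substitutions: the new b and c are the
    values of f at the columns of the substitution. When p divides n, the product
    of two values of f, one of which is b or c, is a square modulo p, so all the
    values of f prime to p have the same Legendre symbol. By primitivity b and c
    are not both divisible by p, so this common symbol is (c/p) or (b/p). *)
Require Import Defs.
From mathcomp Require Import all_boot all_order all_algebra.
From mathcomp Require Import boolp classical_sets reals.
From mathcomp Require Import ring zify.

Import Order.TTheory GRing.Theory Num.Theory.

Local Open Scope classical_set_scope.
Local Open Scope ring_scope.

Lemma Euclid_dvdzM (p : nat) (x y : int) : prime p ->
  (p%:Z %| x * y)%Z = (p%:Z %| x)%Z || (p%:Z %| y)%Z.
Proof. by move=> p_prime; rewrite !dvdzE abszM Euclid_dvdM. Qed.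

Lemma Euclid_dvdz_sqr (p : nat) (x : int) : prime p ->
  (p%:Z %| x ^+ 2)%Z = (p%:Z %| x)%Z.
Proof. by move=> p_prime; rewrite expr2 Euclid_dvdzM // orbb. Qed.

(** Modulo [p], [t * s] is [u ^+ 2] and [t] is [v ^+ 2] with [v] invertible, so [s] is the square of
    [u / v]. *)
Lemma square_mod_cofactor {p : nat} {t s u : int} : prime p ->
  ~~ (p%:Z %| t)%Z -> (p%:Z %| t * s - u ^+ 2)%Z ->
  (exists v : int, (v ^+ 2 = t %[mod p%:Z])%Z) ->
  exists v : int, (v ^+ 2 = s %[mod p%:Z])%Z.
Proof.
move=> p_prime pt /dvdzP[k tsu] [v /eqP]; rewrite eqz_mod_dvd => /dvdzP[l vt].
have pv : coprimez p%:Z v.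
  rewrite coprimezE /= prime_coprime //; apply: contra pt => pv.
  have -> : t = v ^+ 2 - l * p%:Z by rewrite -vt; ring.
  by rewrite rpredB ?Euclid_dvdz_sqr ?dvdz_mull.
(* Bezout gives [w1 * p + w2 * v = 1], so [w2] inverts [v] modulo [p]. *)
have [[w1 w2] /= w] := coprimezP _ _ pv.
exists (u * w2); apply/eqP; rewrite eqz_mod_dvd; apply/dvdzP.
have -> : (u * w2) ^+ 2 - s =
    - (t * s - u ^+ 2) * w2 ^+ 2 - (v ^+ 2 - t) * s * w2 ^+ 2
    + s * ((w2 * v) ^+ 2 - 1) by ring.
rewrite tsu vt; have -> : w2 * v = 1 - w1 * p%:Z by rewrite -w; ring.
exists (- k * w2 ^+ 2 - l * s * w2 ^+ 2 + s * (w1 ^+ 2 * p%:Z - 2 * w1)).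
by ring.
Qed.

Lemma legendre_eq0 (p : nat) (t : int) : (legendre t p == 0) = (p%:Z %| t)%Z.
Proof. by rewrite /legendre; case: ifP => // _; case: ifP. Qed.

(** The condition on [t * s] is symmetric in [t] and [s], so being a square passes both ways. *)
Lemma legendre_cofactor {p : nat} {t s u : int} : prime p ->
  ~~ (p%:Z %| t)%Z -> ~~ (p%:Z %| s)%Z -> (p%:Z %| t * s - u ^+ 2)%Z ->
  legendre s p = legendre t p.
Proof.
move=> p_prime pt ps tsu; rewrite /legendre (negbTE pt) (negbTE ps).
congr (if _ then _ else _); apply: asbool_equiv_eq; split.
  by apply: (square_mod_cofactor p_prime ps (u := u)); rewrite mulrC.
exact: (square_mod_cofactor p_prime pt tsu).
Qed.

(** Irrationality of the square root of [n]: a nonzero [v] would divide [u], and the quotient would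
    have square [n]. *)
Lemma nonsquare_ratio (n : nat) (u v : int) :
  ~ (exists m : nat, n = (m ^ 2)%N) -> u ^+ 2 = v ^+ 2 * n%:Z -> v = 0.
Proof.
move=> n_nsq uv; apply: contrapT => /eqP v0; apply: n_nsq.
have uvN : (`|u| ^ 2 = `|v| ^ 2 * n)%N by rewrite -!abszX uv abszM.
have /dvdnP[m um] : (`|v| %| `|u|)%N by rewrite -(@dvdn_pexp2r _ _ 2) // uvN dvdn_mulr.
exists m; apply/eqP; rewrite -(@eqn_pmul2l (`|v| ^ 2)) ?expn_gt0 ?absz_gt0 ?v0 //.
by rewrite -uvN um expnMn mulnC.
Qed.

(** With f(X, Y) = b X^2 + 2 a X Y + c Y^2, the new [b] and [c] are f(A, B) and f(C, D), and the new
    [a] is the polar form of f at these two vectors. *)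
Lemma quad_irr_moebius {R : realType} {n : nat} {alpha : R} {a b c : int}
    (A B C D : int) : ~ (exists m : nat, n = (m ^ 2)%N) ->
  A * D - B * C = 1 -> quad_irr n alpha a b c ->
  exists2 beta : R, moebius A B C D (Some alpha) = Some beta &
    quad_irr n beta (A * C * b + (A * D + B * C) * a + B * D * c)
      (A ^+ 2 * b + 2 * A * B * a + B ^+ 2 * c)
      (C ^+ 2 * b + 2 * C * D * a + D ^+ 2 * c).
Proof.
move=> n_nsq det [c0 bc abc ->].
set a' := A * C * b + _ + _; set b' := A ^+ 2 * b + _ + _.
set c' := C ^+ 2 * b + _ + _; set s := Num.sqrt n%:R.
have cc' : c * c' = (C * a + D * c) ^+ 2 - C ^+ 2 * n%:Z.
  transitivity (C ^+ 2 * (b * c) + 2 * C * D * a * c + D ^+ 2 * c ^+ 2).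
    by rewrite /c'; ring.
  by rewrite bc; ring.
(* A zero [c'] forces [C = 0] by irrationality, then [D = 0], against determinant 1. *)
have c'0 : c' != 0.
  apply/eqP => c'0; have /eqP := cc'; rewrite c'0 mulr0 eq_sym subr_eq0 => /eqP e.
  have C0 := nonsquare_ratio _ _ _ n_nsq e.
  move: e det; rewrite C0 mul0r add0r expr0n mul0r => /eqP.
  by rewrite sqrf_eq0 mulf_eq0 (negbTE c0) orbF => /eqP->; lia.
have bc' : b' * c' = a' ^+ 2 - n%:Z.
  transitivity (a' ^+ 2 + (A * D - B * C) ^+ 2 * (b * c - a ^+ 2)).
    by rewrite /a' /b' /c'; ring.
  by rewrite det bc; ring.
have abc' : gcdz (gcdz a' b') c' = 1.
  set d := gcdz _ _.
  have dc : (d %| c')%Z := dvdz_gcdr _ _.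
  have da : (d %| a')%Z := dvdz_trans (dvdz_gcdl _ _) (dvdz_gcdl _ _).
  have db : (d %| b')%Z := dvdz_trans (dvdz_gcdl _ _) (dvdz_gcdr _ _).
  (* The inverse substitution writes [a], [b], [c] as integer combinations of [a'], [b'], [c']. *)
  have : (d %| gcdz (gcdz a b) c)%Z.
    rewrite !dvdz_gcd -andbA.
    have ->: a = (A * D - B * C) ^+ 2 * a by rewrite det; ring.
    have ->: b = (A * D - B * C) ^+ 2 * b by rewrite det; ring.
    have ->: c = (A * D - B * C) ^+ 2 * c by rewrite det; ring.
    have ->: (A * D - B * C) ^+ 2 * a =
      (A * D + B * C) * a' - C * D * b' - A * B * c'
      by rewrite /a' /b' /c'; ring.
    have ->: (A * D - B * C) ^+ 2 * b = D ^+ 2 * b' - 2 * B * D * a' + B ^+ 2 * c'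
      by rewrite /a' /b' /c'; ring.
    have ->: (A * D - B * C) ^+ 2 * c = C ^+ 2 * b' - 2 * A * C * a' + A ^+ 2 * c'
      by rewrite /a' /b' /c'; ring.
    by apply/and3P; split; rewrite !rpredD ?rpredN ?dvdz_mull.
  by rewrite abc dvdz1 => /eqP d1; exact: (congr1 Posz d1 : d = 1).
have s2 : s ^+ 2 = n%:R by rewrite sqr_sqrtr ?ler0n.
have cR : c%:~R != 0 :> R by rewrite intr_eq0.
have c'R : c'%:~R != 0 :> R by rewrite intr_eq0.
have detR : A%:~R * D%:~R - B%:~R * C%:~R = 1 :> R by rewrite -!intrM -intrB det.
have bcR : b%:~R * c%:~R = a%:~R ^+ 2 - s ^+ 2 :> R.
  by rewrite s2 -intrM bc intrB rmorphXn.
have c'E : c'%:~R = C%:~R ^+ 2 * b%:~R + 2 * C%:~R * D%:~R * a%:~R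
    + D%:~R ^+ 2 * c%:~R :> R.
  by rewrite /c' !(rmorphD, rmorphM, rmorphXn).
have a'E : a'%:~R = A%:~R * C%:~R * b%:~R
    + (A%:~R * D%:~R + B%:~R * C%:~R) * a%:~R + B%:~R * D%:~R * c%:~R :> R.
  by rewrite /a' !(rmorphD, rmorphM).
set z := (a%:~R + s) / c%:~R.
(* Rationalize the fraction by the conjugate of its denominator. *)
have norm : (C%:~R * z + D%:~R) * (C%:~R * a%:~R + D%:~R * c%:~R - C%:~R * s)
    = c'%:~R :> R.
  apply: (mulfI cR); transitivity
    (C%:~R ^+ 2 * (a%:~R ^+ 2 - s ^+ 2) + 2 * C%:~R * D%:~R * a%:~R * c%:~R
      + D%:~R ^+ 2 * c%:~R ^+ 2 : R).
    by rewrite /z; field.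
  by rewrite -bcR c'E; ring.
(* The coefficient of [s] in this product is the determinant. *)
have numer : (A%:~R * z + B%:~R) * (C%:~R * a%:~R + D%:~R * c%:~R - C%:~R * s)
    = a'%:~R + s :> R.
  apply: (mulfI cR); transitivity
    (A%:~R * C%:~R * (a%:~R ^+ 2 - s ^+ 2)
      + (A%:~R * D%:~R + B%:~R * C%:~R) * a%:~R * c%:~R
      + B%:~R * D%:~R * c%:~R ^+ 2
      + (A%:~R * D%:~R - B%:~R * C%:~R) * s * c%:~R : R).
    by rewrite /z; field.
  by rewrite -bcR detR a'E; ring.
have den0 : C%:~R * z + D%:~R != 0.
  by apply: contraNneq c'R => z0; rewrite -norm z0 mul0r.
exists ((a'%:~R + s) / c'%:~R); last by split.
rewrite /moebius (negbTE den0); congr Some; apply/eqP.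
by rewrite eqr_div // -numer -norm; apply/eqP; ring.
Qed.

(** Otherwise [p] would also divide a^2 = b c + n, hence [a], against primitivity. *)
Lemma quad_irr_ndvd {R : realType} {n p : nat} {alpha : R} {a b c : int} :
  prime p -> (p %| n)%N -> quad_irr n alpha a b c ->
  (p%:Z %| c)%Z -> ~~ (p%:Z %| b)%Z.
Proof.
move=> p_prime pn [_ bc abc _] pc; apply/negP => pb.
have pa : (p%:Z %| a)%Z.
  rewrite -Euclid_dvdz_sqr // -[a ^+ 2](subrK n%:Z) -bc.
  by rewrite rpredD // dvdz_mull.
have : (p%:Z %| gcdz (gcdz a b) c)%Z by rewrite !dvdz_gcd pa pb pc.
by rewrite abc dvdz1 /= => /eqP p1; move: p_prime; rewrite p1.
Qed.

(** One argument serves both signs: as [e] is nonzero, a symbol equal to [e] certifies that [p] does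
    not divide the coefficient. *)
Lemma G_subset_class {R : realType} {p n : nat} {e : int} :
  prime p -> ~ (exists m : nat, n = (m ^ 2)%N) -> (p %| n)%N -> e != 0 ->
  G_subset n (@classA R n p e `|` @classC R n p e).
Proof.
move=> p_prime n_nsq pn e0; split.
  by move=> z [[a [b [c [q _]]]]|[a [b [c [q _ _]]]]]; exists a, b, c.
move=> g /modular_groupP[A [B [C [D [det ->]]]]] _ [_ [z Sz <-] <-].
have [a [b [c [q ce]]]] : exists a b c : int, quad_irr n z a b c /\
    (legendre c p = e \/ legendre b p = e).
  by case: Sz => [[a [b [c [q ?]]]]|[a [b [c [q _ ?]]]]];
    exists a, b, c; split; auto.
have [z' -> q'] := quad_irr_moebius _ _ _ _ n_nsq det q.
exists z' => //; have bc : b * c = a ^+ 2 - n%:Z by case: q.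
(* For a value [t] of f, [c * t] and [b * t] are squares minus [X ^+ 2 * n] and [Y ^+ 2 * n], hence
   squares modulo [p]. *)
have leg X Y : let t := X ^+ 2 * b + 2 * X * Y * a + Y ^+ 2 * c in
    ~~ (p%:Z %| t)%Z -> legendre t p = e.
  move=> t pt; case: ce => le; rewrite -le.
    apply: (legendre_cofactor (u := X * a + Y * c)) => //.
      by rewrite -legendre_eq0 le.
    have -> : c * t - (X * a + Y * c) ^+ 2 = X ^+ 2 * (b * c - a ^+ 2).
      by rewrite /t; ring.
    by rewrite bc addrAC subrr add0r dvdz_mull // rpredN.
  apply: (legendre_cofactor (u := X * b + Y * a)) => //.
    by rewrite -legendre_eq0 le.
  have -> : b * t - (X * b + Y * a) ^+ 2 = Y ^+ 2 * (b * c - a ^+ 2).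
    by rewrite /t; ring.
  by rewrite bc addrAC subrr add0r dvdz_mull // rpredN.
(* The symbol is read at (C, D) for the new [c], or at (A, B) for the new [b] when [p] divides the
   new [c]. *)
have [pc'|pc'] := boolP (p%:Z %| C ^+ 2 * b + 2 * C * D * a + D ^+ 2 * c)%Z.
  right; do 3 eexists; split; [exact: q' | exact: pc' |].
  by apply: leg; exact: quad_irr_ndvd q' pc'.
by left; do 3 eexists; split; [exact: q' | exact: leg].
Qed.

Theorem theorem3p3 (R : realType) (p n : nat)
    (p_prime : prime p) (p_odd : odd p)
    (n_gt0 : (0 < n)%N) (n_nonsquare : ~ exists m : nat, n = (m ^ 2)%N)
    (n_mod_p : n = 0 %[mod p]) :
  let A1 := @classA R n p 1 in
  let A2 := @classA R n p (-1) in
  let C1 := @classC R n p 1 in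
  let C2 := @classC R n p (-1) in
  G_subset n (A1 `|` C1) /\ G_subset n (A2 `|` C2).
Proof.
have pn : (p %| n)%N by rewrite /dvdn n_mod_p mod0n.
by split; apply: G_subset_class.
Qed.
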